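(* For every $n\ge1$ and every $t\ge 2n$, there exist informationally complete $t$-doped POVMs on $n$ data qubits.
   Context: A $t$-doped POVM on $n$ data qubits is defined as follows: take $m\ge0$ ancilla qubits in a stabilizer state $\ket\psi\in(\mathbb{C}^2)^{\otimes m}$, a unitary $U$ on $n+m$ qubits implemented by a circuit of Clifford gates (generated by Hadamard, phase $S$ and CNOT gates) together with $t$ gates $T=\mathrm{diag}(1,e^{i\pi/4})$, and a stabilizer basis $\{\ket{\Phi'_b}\}_{b=1}^{2^{n+m}}$ (the common eigenbasis of $n+m$ independent commuting Pauli operators). Its elements are $\mu_b=(I\otimes\bra\psi)U^\dagger\ket{\Phi'_b}\!\bra{\Phi'_b}U(I\otimes\ket\psi)$, operators on $(\mathbb{C}^2)^{\otimes n}$. A stabilizer state is the unique state stabilized by an abelian subgroup of order $2^m$ of the $m$-qubit Pauli group not containing $-I$. The POVM is informationally complete if $\dim\operatorname{span}\{\mu_b\}=4^n$. *)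

(* Defs.v *)
(* complex amplitudes in algC (algebraic complex numbers). *)
From mathcomp Require Import all_boot all_order all_algebra.
From mathcomp Require Import algC.
Set Implicit Arguments. Unset Strict Implicit. Unset Printing Implicit Defensive.
Import Order.TTheory GRing.Theory Num.Theory.
Local Open Scope ring_scope.

(* Qubit conventions: a register of N qubits is C^(2^N); basis index k : 'I_(2^N)
   and qubit j carries the bit [bit j k] (bit j of the binary expansion of k). *)
Definition bit (j k : nat) : bool := odd (k %/ 2 ^ j).

(* conjugate transpose *)
Definition adj (p q : nat) (A : 'M[algC]_(p, q)) : 'M[algC]_(q, p) :=
  (map_mx (fun x : algC => x^*) A)^T.

(* single-qubit gates as 2x2 matrices indexed by bits (false = |0>) *)
Definition Hg (a b : bool) : algC := (if a && b then -1 else 1) / sqrtC 2.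
Definition Sg (a b : bool) : algC := if a == b then (if a then 'i else 1) else 0.
Definition omega8 : algC := (1 + 'i) / sqrtC 2. (* = e^{i pi/4} *)
Definition Tg (a b : bool) : algC := if a == b then (if a then omega8 else 1) else 0.

(* G acting on qubit i of N qubits (identity on the others) *)
Definition embed1 (N : nat) (i : 'I_N) (G : bool -> bool -> algC) : 'M[algC]_(2 ^ N) :=
  \matrix_(r, c) if [forall j : 'I_N, (j != i) ==> (bit j r == bit j c)]
                 then G (bit i r) (bit i c) else 0.

(* CNOT with control ctl and target tgt: |c> |-> |c xor [bit ctl c] e_tgt> *)
Definition cnot_mx (N : nat) (ctl tgt : 'I_N) : 'M[algC]_(2 ^ N) :=
  \matrix_(r, c) ((r : nat) == (if bit ctl c then
                                  (if bit tgt c then c - 2 ^ tgt else c + 2 ^ tgt)%N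
                                else (c : nat)))%:R.

Inductive gate (N : nat) : Type :=
| GH of 'I_N | GS of 'I_N | GCNOT of 'I_N & 'I_N | GT of 'I_N.

Definition gate_mx (N : nat) (g : gate N) : 'M[algC]_(2 ^ N) :=
  match g with
  | GH i => embed1 i Hg
  | GS i => embed1 i Sg
  | GCNOT c t => cnot_mx c t
  | GT i => embed1 i Tg
  end.

Definition wf_gate (N : nat) (g : gate N) : bool :=
  if g is GCNOT c t then c != t else true.

Definition is_T (N : nat) (g : gate N) : bool := if g is GT _ then true else false.

(* the circuit [:: g1; ...; gk] implements U = gk * ... * g1 *)
Definition circuit_mx (N : nat) (c : seq (gate N)) : 'M[algC]_(2 ^ N) :=
  foldr (fun g M => M *m gate_mx g) 1%:M c.

(* Pauli matrices: 0 = I, 1 = X, 2 = Y, 3 = Z *)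
Definition sigma (p : 'I_4) (a b : bool) : algC :=
  match val p with
  | 0 => (a == b)%:R
  | 1 => (a != b)%:R
  | 2 => if a == b then 0 else (if a then 'i else - 'i)
  | _ => if a == b then (if a then -1 else 1) else 0
  end.

Definition pauli_mx (N : nat) (s : 'I_N -> 'I_4) : 'M[algC]_(2 ^ N) :=
  \matrix_(r, c) \prod_(j < N) sigma (s j) (bit j r) (bit j c).

(* element of the N-qubit Pauli group: i^k * (tensor product of I, X, Y, Z) *)
Definition is_pauli (N : nat) (M : 'M[algC]_(2 ^ N)) : Prop :=
  exists (k : nat) (s : 'I_N -> 'I_4), M = ('i ^+ k) *: pauli_mx s.

(* Hermitian Pauli operator: +- (tensor product of I, X, Y, Z) *)
Definition is_herm_pauli (N : nat) (M : 'M[algC]_(2 ^ N)) : Prop :=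
  exists (b : bool) (s : 'I_N -> 'I_4), M = ((-1) ^+ b) *: pauli_mx s.

(* abelian subgroup of order 2^m of the m-qubit Pauli group not containing -I *)
Definition is_stabilizer_group (m : nat) (G : seq 'M[algC]_(2 ^ m)) : Prop :=
  [/\ uniq G, size G = (2 ^ m)%N, (forall A, A \in G -> is_pauli A),
      1%:M \in G & - 1%:M \notin G] /\
  (forall A B, A \in G -> B \in G -> A *m B \in G) /\
  (forall A B, A \in G -> B \in G -> A *m B = B *m A).

(* stabilizer state: the unique (unit) state stabilized by such a group *)
Definition is_stabilizer_state (m : nat) (psi : 'cV[algC]_(2 ^ m)) : Prop :=
  adj psi *m psi = 1%:M /\
  exists G : seq 'M[algC]_(2 ^ m), is_stabilizer_group G /\
    (forall v : 'cV[algC]_(2 ^ m),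
        (forall A, A \in G -> A *m v = v) <-> exists a : algC, v = a *: psi).

(* stabilizer basis: orthonormal common eigenbasis of N independent commuting
   Pauli operators *)
Definition is_stabilizer_basis (N : nat) (Phi : 'I_(2 ^ N) -> 'cV[algC]_(2 ^ N)) : Prop :=
  exists P : 'I_N -> 'M[algC]_(2 ^ N),
    [/\ (forall j, is_herm_pauli (P j)),
        (forall j k, P j *m P k = P k *m P j),
        (forall A : {set 'I_N}, A != set0 ->
            ~ exists a : algC, \prod_(j in A) P j = a%:M),
        (forall b j, exists lam : algC, P j *m Phi b = lam *: Phi b)
      & (forall b b', adj (Phi b) *m Phi b' = ((b == b')%:R)%:M)].

Lemma anc_index_proof (n m : nat) (k : 'I_(2 ^ (n + m))) : (k %/ 2 ^ n < 2 ^ m)%N.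
Proof. by rewrite ltn_divLR ?expn_gt0 // -expnD (addnC m n) ltn_ord. Qed.

(* ancilla part of a basis index (data qubits = bits 0..n-1, ancillas = bits n..n+m-1) *)
Definition anc_index (n m : nat) (k : 'I_(2 ^ (n + m))) : 'I_(2 ^ m) :=
  Ordinal (anc_index_proof k).

(* the isometry I (x) |psi> : C^(2^n) -> C^(2^(n+m)) *)
Definition anc_embed (n m : nat) (psi : 'cV[algC]_(2 ^ m)) : 'M[algC]_(2 ^ (n + m), 2 ^ n) :=
  \matrix_(k, a) if (k %% 2 ^ n)%N == a then psi (anc_index k) 0 else 0.

(* mu = (I (x) <psi|) U^dag |phi><phi| U (I (x) |psi>) *)
Definition povm_elt (n m : nat) (psi : 'cV[algC]_(2 ^ m)) (U : 'M[algC]_(2 ^ (n + m)))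
  (phi : 'cV[algC]_(2 ^ (n + m))) : 'M[algC]_(2 ^ n) :=
  adj (anc_embed n psi) *m adj U *m (phi *m adj phi) *m U *m anc_embed n psi.

(* mu is a t-doped POVM on n data qubits with m ancillas *)
Definition is_t_doped_POVM (n t m : nat) (mu : 'I_(2 ^ (n + m)) -> 'M[algC]_(2 ^ n)) : Prop :=
  exists (psi : 'cV[algC]_(2 ^ m)) (c : seq (gate (n + m)))
         (Phi : 'I_(2 ^ (n + m)) -> 'cV[algC]_(2 ^ (n + m))),
    [/\ is_stabilizer_state psi, all (@wf_gate _) c, count (@is_T _) c = t,
        is_stabilizer_basis Phi
      & forall b, mu b = povm_elt psi (circuit_mx c) (Phi b)].

(* dim span {mu_b} = 4^n *)
Definition informationally_complete (n K : nat) (mu : 'I_K -> 'M[algC]_(2 ^ n)) : Prop :=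
  \rank (\matrix_(b < K) mxvec (mu b)) = (4 ^ n)%N.

Arguments is_t_doped_POVM n t m mu : clear implicits.
Arguments informationally_complete n K mu : clear implicits.

(* Main.v *)
(* Attach one ancilla to each data qubit and prepare the ancillas in the magic
   state THTH|0>, at a cost of two T gates each; then measure every data/ancilla
   pair in the Bell basis. The elements on one data qubit are the four Pauli
   conjugates of a pure state whose X, Y and Z expectations are all nonzero, so
   they span the 2x2 matrices; the n-qubit elements are their tensor products.
   Surplus T gates are absorbed by an ancilla that is still in the state |0>. *)
Require Import Defs.
From mathcomp Require Import all_boot all_order all_algebra.
From mathcomp Require Import algC.
From mathcomp Require Import zify ring.
Set Implicit Arguments. Unset Strict Implicit. Unset Printing Implicit Defensive.
Import Order.TTheory GRing.Theory Num.Theory.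
Local Open Scope ring_scope.

(** * Binary digits of basis indices *)

Lemma bitS (j k : nat) : bit j.+1 k = bit j k./2.
Proof. by rewrite /bit expnS divnMA divn2. Qed.

Lemma bit_eq (N r c : nat) : (r < 2 ^ N)%N -> (c < 2 ^ N)%N ->
  (forall j, (j < N)%N -> bit j r = bit j c) -> r = c.
Proof.
elim: N r c => [|N IHN] r c; first by rewrite expn0; case: r c => [|r] [|c].
rewrite expnS => ltr ltc Hb.
have /eqP := Hb 0%N isT; rewrite /bit expn0 !divn1 => /eqP Hodd.
rewrite -(odd_double_half r) -(odd_double_half c) Hodd; congr (_ + _.*2)%N.
apply: IHN => [||j ltj]; rewrite ?ltn_half_double -?muln2 1?mulnC //; try lia.
by rewrite -!bitS Hb.
Qed.

(** No carry arises when bit [t] is clear, so the addition flips that bit alone; this is the target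
    flip inside [cnot_mx]. *)
Lemma bit_addX (t j k : nat) : ~~ bit t k -> bit j (k + 2 ^ t) = bit j k (+) (j == t).
Proof.
elim: t j k => [|t IHt] j k.
  rewrite {1}/bit expn0 divn1 addn1 => evk.
  case: j => [|j]; first by rewrite /bit expn0 !divn1 /= addbT.
  by rewrite !bitS /= addbF uphalf_half (negbTE evk).
rewrite bitS expnS mul2n => Hk.
have Hh : (k + (2 ^ t).*2)./2 = (k./2 + 2 ^ t)%N by rewrite halfD odd_double andbF doubleK.
case: j => [|j]; last by rewrite !bitS Hh IHt.
by rewrite /bit expn0 !divn1 oddD odd_double addbF.
Qed.

Lemma bit_subX (t j k : nat) : bit t k -> bit j (k - 2 ^ t) = bit j k (+) (j == t).
Proof.
move=> Hk; have le_tk : (2 ^ t <= k)%N.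
  by rewrite leqNgt; apply: contraL Hk => ?; rewrite /bit divn_small.
move: Hk; rewrite -{1 3}(subnK le_tk) => Hk.
have {}Hk : ~~ bit t (k - 2 ^ t).
  by move: Hk; rewrite /bit divnDr ?dvdnn // divnn expn_gt0 addn1.
by rewrite bit_addX // -addbA addbb addbF.
Qed.

Lemma bit_mod (j n k : nat) : (j < n)%N -> bit j (k %% 2 ^ n) = bit j k.
Proof.
move=> ltj; rewrite {2}(divn_eq k (2 ^ n)) /bit -[in (_ * 2 ^ n)%N](subnK (ltnW ltj)).
rewrite expnD mulnA divnMDl ?expn_gt0 // oddD oddM.
by rewrite oddX subn_eq0 leqNgt ltj andbF.
Qed.

Lemma bit_div (j n k : nat) : bit j (k %/ 2 ^ n) = bit (n + j) k.
Proof. by rewrite /bit -divnMA -expnD. Qed.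

Lemma bit0n (j : nat) : bit j 0 = false.
Proof. by rewrite /bit div0n. Qed.

Lemma bitX (i j : nat) : bit j (2 ^ i) = (j == i).
Proof. by rewrite -(add0n (2 ^ i)%N) bit_addX bit0n. Qed.

Definition bits (N : nat) (k : 'I_(2 ^ N)) : {ffun 'I_N -> bool} := [ffun j : 'I_N => bit j k].

Lemma bits_inj N : injective (@bits N).
Proof.
move=> r c /ffunP Hrc; apply/val_inj/(@bit_eq N) => [||j ltj]; rewrite ?ltn_ord //.
by have := Hrc (Ordinal ltj); rewrite !ffunE.
Qed.

Lemma bits_bij N : bijective (@bits N).
Proof. by apply: inj_card_bij (@bits_inj N) _; rewrite card_ffun card_bool !card_ord. Qed.

Lemma bitsP N (r c : 'I_(2 ^ N)) : reflect (forall j : 'I_N, bit j r = bit j c) (r == c).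
Proof.
apply: (iffP eqP) => [-> //|Hrc]; apply: bits_inj.
by apply/ffunP => j; rewrite !ffunE.
Qed.

Lemma bits_surj N (f : 'I_N -> bool) : exists k : 'I_(2 ^ N), forall j : 'I_N, bit j k = f j.
Proof.
have [g _ gK] := bits_bij N; exists (g [ffun j => f j]) => j.
by have /ffunP/(_ j) := gK [ffun j => f j]; rewrite !ffunE.
Qed.

(** * Sums over basis indices, product vectors and gates acting on them *)

Lemma prod_indicator (I : finType) (P : pred I) :
  \prod_(i : I) (P i)%:R = [forall i, P i]%:R :> algC.
Proof.
case: (boolP [forall i, P i]) => [/forallP HP|]; first by rewrite big1 // => i; rewrite HP.
by rewrite negb_forall => /existsP[i /negbTE HP]; rewrite (bigD1 i) //= HP mul0r.
Qed.

Lemma sum_prod_bit N (F : 'I_N -> bool -> algC) :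
  \sum_(k < 2 ^ N) \prod_(j < N) F j (bit j k) = \prod_(j < N) \sum_(x : bool) F j x.
Proof.
rewrite bigA_distr_bigA /= (reindex (@bits N)) /=; last exact: onW_bij (bits_bij N).
by apply: eq_bigr => k _; apply: eq_bigr => j _; rewrite ffunE.
Qed.

Lemma sum2_prod_bit N (F : 'I_N -> bool -> bool -> algC) :
  \sum_(k < 2 ^ N) \sum_(l < 2 ^ N) \prod_(j < N) F j (bit j k) (bit j l) =
  \prod_(j < N) \sum_(x : bool) \sum_(y : bool) F j x y.
Proof.
rewrite -(sum_prod_bit (fun j x => \sum_y F j x y)); apply: eq_bigr => k _.
exact: (sum_prod_bit (fun j => F j (bit j k))).
Qed.

(** Tensor products of one-qubit vectors. On an input |a>|0> every intermediate state of the circuit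
    stays in this form, since each CNOT acts while its control is still a basis state. *)
Definition prod_vec N (f : 'I_N -> bool -> algC) : 'cV[algC]_(2 ^ N) :=
  \col_k \prod_(j < N) f j (bit j k).

Lemma eq_prod_vec N (f g : 'I_N -> bool -> algC) :
  (forall j x, f j x = g j x) -> prod_vec f = prod_vec g.
Proof. by move=> Hfg; apply/colP => k; rewrite !mxE; apply: eq_bigr. Qed.

Definition gate1 (G : bool -> bool -> algC) (f : bool -> algC) (x : bool) : algC :=
  \sum_(y : bool) G x y * f y.

Lemma embed1_prod_vec N (i : 'I_N) G (f : 'I_N -> bool -> algC) :
  embed1 i G *m prod_vec f = prod_vec (fun j => if j == i then gate1 G (f i) else f j).
Proof.
apply/colP => r; rewrite !mxE.
pose F j x := (if j == i then G (bit j r) x else (bit j r == x)%:R) * f j x.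
transitivity (\sum_(k < 2 ^ N) \prod_(j < N) F j (bit j k)).
  apply: eq_bigr => k _; rewrite !mxE big_split /=; congr (_ * _).
  rewrite (bigD1 i) //= eqxx.
  rewrite (eq_bigr (fun j : 'I_N => (bit j r == bit j k)%:R)) => [|j /negbTE-> //].
  rewrite big_mkcond /= (eq_bigr (fun j : 'I_N => ((j != i) ==> (bit j r == bit j k))%:R)).
    by rewrite prod_indicator; case: ifP; rewrite ?mulr1 ?mulr0.
  by move=> j _; case: (j == i).
rewrite sum_prod_bit; apply: eq_bigr => j _; rewrite /F.
case: eqVneq => [->|_] //.
by rewrite big_bool; case: (bit j r); rewrite /= !(mul1r, mul0r, addr0, add0r).
Qed.

Lemma cnot_prod_vec N (ctl tgt : 'I_N) (f : 'I_N -> bool -> algC) (a : bool) :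
  ctl != tgt -> (forall x, f ctl x = (x == a)%:R) ->
  cnot_mx ctl tgt *m prod_vec f =
  prod_vec (fun j x => if j == tgt then f tgt (x (+) a) else f j x).
Proof.
move=> neq_ct Hctl; apply/colP => r; rewrite !mxE.
(* CNOT is an involutive permutation of the basis, so [k], the image of [r], is the only column that
   meets row [r]. *)
have [k Hk] := bits_surj (fun j : 'I_N => bit j r (+) ((j == tgt) && bit ctl r)).
have Hcnot c : cnot_mx ctl tgt r c = (c == k)%:R.
  rewrite mxE; congr (nat_of_bool _)%:R.
  set fc := (if _ then _ else _).
  have Hfc j : bit j fc = bit j c (+) ((j == tgt :> nat) && bit ctl c).
    rewrite /fc; case: ifP => _; last by rewrite andbF addbF.
    by rewrite andbT; case: ifP => Ht; rewrite ?bit_subX ?bit_addX ?Ht.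
  have neq_ctn : (ctl == tgt :> nat) = false by exact: negbTE neq_ct.
  apply/eqP/bitsP => [Heq j|Heq].
    rewrite Hk Heq !Hfc neq_ctn /= addbF -val_eqE /=.
    by rewrite -addbA addbb addbF.
  (* A priori [fc] is only known to be below [2 ^ N.+1], so one extra bit is compared; it is clear
     on both sides. *)
  have ltS (x : 'I_(2 ^ N)) : (x < 2 ^ N.+1)%N.
    by rewrite (leq_trans (ltn_ord x)) // leq_exp2l.
  apply: (@bit_eq N.+1) => [||j ltj]; first exact: ltS.
    rewrite /fc; case: ifP => _ //; case: ifP => _.
      exact: leq_ltn_trans (leq_subr _ _) (ltS c).
    by rewrite expnS mul2n -addnn -addSn leq_add ?ltn_ord // leq_exp2l // ltnW.
  have [ltjN|leNj] := ltnP j N; last first.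
    have -> : j = N by lia.
    have bitN (x : 'I_(2 ^ N)) : bit N x = false by rewrite /bit divn_small.
    by rewrite Hfc !bitN [N == _]gtn_eqF.
  have := Heq (Ordinal ltjN); rewrite Hfc Hk (Heq ctl) Hk (negbTE neq_ct) /= addbF => ->.
  by rewrite -val_eqE /= -addbA addbb addbF.
rewrite (bigD1 k) //= Hcnot eqxx mul1r big1 => [|c /negbTE neq_ck]; last first.
  by rewrite Hcnot neq_ck mul0r.
rewrite addr0 mxE; case: (eqVneq (bit ctl r) a) => [Hra|/negbTE Hra].
  apply: eq_bigr => j _; rewrite Hk Hra; case: eqVneq => [-> //|_].
  by rewrite addbF.
rewrite (bigD1 ctl) //= Hk (negbTE neq_ct) addbF Hctl Hra mul0r.
by rewrite (bigD1 ctl) //= (negbTE neq_ct) Hctl Hra mul0r.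
Qed.

(** * Z-strings; the computational basis as a stabilizer basis *)

Definition zsign N (S : {set 'I_N}) (k : nat) : algC :=
  \prod_(j < N) (-1) ^+ ((j \in S) && bit j k).

(** The Pauli operator with Z on the qubits of [S], kept diagonal so that products and commutation
    reduce to signs. *)
Definition zstring N (S : {set 'I_N}) : 'M[algC]_(2 ^ N) :=
  diag_mx (\row_k zsign S k).

Lemma zsign_set0 N k : zsign (set0 : {set 'I_N}) k = 1.
Proof. by rewrite /zsign big1 // => j _; rewrite inE. Qed.

Lemma zsign0 N (S : {set 'I_N}) : zsign S 0 = 1.
Proof. by rewrite /zsign big1 // => j _; rewrite bit0n andbF. Qed.

Lemma zsign1 N (i : 'I_N) k : zsign [set i] k = (-1) ^+ bit i k.
Proof.
rewrite /zsign (bigD1 i) //= inE eqxx big1 ?mulr1 // => j /negbTE neq_ji.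
by rewrite inE neq_ji.
Qed.

Lemma zsignX N (S : {set 'I_N}) (i : 'I_N) : zsign S (2 ^ i) = (-1) ^+ (i \in S).
Proof.
rewrite /zsign (bigD1 i) //= bitX eqxx andbT big1 ?mulr1 // => j neq_ji.
by rewrite bitX val_eqE (negbTE neq_ji) andbF.
Qed.

Lemma zsignM N (S T : {set 'I_N}) k :
  zsign S k * zsign T k = zsign [set j | (j \in S) (+) (j \in T)] k.
Proof.
rewrite -big_split; apply: eq_bigr => j _; rewrite inE /= -signr_addb.
by case: (bit j k); rewrite ?andbT ?andbF.
Qed.

Lemma zstring_mxE N (S : {set 'I_N}) r c : zstring S r c = zsign S c *+ (r == c).
Proof. by rewrite !mxE; case: eqVneq => [->|]. Qed.

Lemma zstringM N (S T : {set 'I_N}) :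
  zstring S *m zstring T = zstring [set j | (j \in S) (+) (j \in T)].
Proof. by rewrite mulmx_diag; congr diag_mx; apply/rowP => k; rewrite !mxE zsignM. Qed.

Lemma zstringC N (S T : {set 'I_N}) : zstring S *m zstring T = zstring T *m zstring S.
Proof. by rewrite !zstringM; congr zstring; apply/setP => j; rewrite !inE addbC. Qed.

Lemma zstring0 N : zstring (set0 : {set 'I_N}) = 1%:M.
Proof. by apply/matrixP => r c; rewrite zstring_mxE zsign_set0 mxE. Qed.

Lemma ltn_bit N (i : 'I_N) : (2 ^ i < 2 ^ N)%N.
Proof. by rewrite ltn_exp2l. Qed.

Lemma zstring_diag N (S : {set 'I_N}) r : zstring S r r = zsign S r.
Proof. by rewrite zstring_mxE eqxx. Qed.

(** The diagonal entry at index [2 ^ i], where only qubit [i] is set, reveals whether [i] belongs to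
    the set. *)
Lemma zstring_inj N : injective (@zstring N).
Proof.
move=> S T eqST; apply/setP => i.
have /matrixP/(_ (Ordinal (ltn_bit i)) (Ordinal (ltn_bit i))) := eqST.
by rewrite !zstring_diag !zsignX => /eqP;
  rewrite (inj_eq (@signr_inj _)) => /eqP.
Qed.

Lemma zstring_pauli N (S : {set 'I_N}) :
  zstring S = pauli_mx (fun j => if j \in S then inord 3 else ord0).
Proof.
apply/matrixP => r c; rewrite zstring_mxE mxE -mulr_natl.
rewrite (eq_bigr (fun j : 'I_N => (bit j r == bit j c)%:R * (-1) ^+ ((j \in S) && bit j c))).
  rewrite big_split /= prod_indicator /zsign; congr (_ * _).
  by congr (nat_of_bool _)%:R; apply/bitsP/forallP => [Hj j|Hj j]; apply/eqP.
move=> j _; rewrite /sigma; case: ifP => _ /=; last by rewrite mulr1.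
by rewrite inordK //=; case: (bit j r); case: (bit j c); rewrite !(mul0r, mul1r).
Qed.

Definition ket N (k : 'I_(2 ^ N)) : 'cV[algC]_(2 ^ N) := delta_mx k 0.

Lemma zstring_ket N (S : {set 'I_N}) k : zstring S *m ket k = zsign S k *: ket k.
Proof.
apply/colP => r; rewrite mul_diag_mx !mxE eqxx andbT.
by case: eqVneq => [->|_]; rewrite ?mulr0.
Qed.

Lemma ket_orthonormal N (k l : 'I_(2 ^ N)) : adj (ket k) *m ket l = ((k == l)%:R)%:M.
Proof.
apply/matrixP => i j; rewrite !ord1 /adj map_delta_mx trmx_delta mul_delta_mx_cond.
by case: (k == l); rewrite !mxE ?eqxx.
Qed.

Definition ord0X N : 'I_(2 ^ N) :=
  Ordinal (eq_ind_r is_true isT (expn_gt0 2 N)).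

Lemma ket0_stabilizer m : is_stabilizer_state (ket (ord0X m)).
Proof.
split; first by rewrite ket_orthonormal eqxx.
exists [seq zstring A | A : {set 'I_m}]; split; last first.
  move=> v; split=> [Hv|[a ->] _ /imageP[S _ ->]]; last first.
    by rewrite -scalemxAr zstring_ket zsign0 scale1r.
  exists (v (ord0X m) 0); apply/colP => k; rewrite !mxE eqxx andbT.
  case: eqVneq => [->|neq_k0]; rewrite ?mulr1 // mulr0.
  have [j Hj] : exists j : 'I_m, bit j k.
    apply/existsP; apply: contraNT neq_k0; rewrite negb_exists => /forallP Hk.
    by apply/bitsP => j; rewrite bit0n; apply: negbTE.
  (* Z on a qubit that is set in [k] negates the amplitude at [k], which must therefore vanish. *)
  have /colP/(_ k) : zstring [set j] *m v = v by apply: Hv; apply: image_f.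
  rewrite mul_diag_mx !mxE zsign1 Hj mulN1r => /eqP.
  by rewrite eqNr => /eqP.
split; last split.
- split.
  + by rewrite map_inj_uniq ?enum_uniq //; apply: zstring_inj.
  + by rewrite size_map -cardE -cardsT -powersetT card_powerset cardsT card_ord.
  + by move=> _ /imageP[S _ ->]; exists 0%N, (fun j => if j \in S then inord 3 else ord0);
      rewrite scale1r zstring_pauli.
  + by rewrite -zstring0; apply: image_f.
  + apply/imageP => -[S _ /matrixP/(_ (ord0X m) (ord0X m))/eqP].
    by rewrite zstring_diag zsign0 !mxE eqxx eqNr oner_eq0.
- move=> _ _ /imageP[S _ ->] /imageP[T _ ->].
  by rewrite zstringM; apply: image_f.
- by move=> _ _ /imageP[S _ ->] /imageP[T _ ->]; apply: zstringC.
Qed.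

Lemma prod_zstring N (S : {set 'I_N}) : \prod_(j in S) zstring [set j] = zstring S.
Proof.
have -> : zstring S = diag_mx (\row_k \prod_(j in S) zsign [set j] k).
  congr diag_mx; apply/rowP => k; rewrite !mxE [RHS]big_mkcond.
  by apply: eq_bigr => j _; rewrite zsign1; case: (j \in S).
elim: (index_enum _) => [|j s IHs].
  by rewrite big_nil; apply/matrixP => r c; rewrite !mxE big_nil.
rewrite big_cons IHs; case: (boolP (j \in S)) => jS.
  rewrite [_ * _]mulmx_diag; congr diag_mx; apply/rowP => k.
  by rewrite !mxE big_cons jS.
by congr diag_mx; apply/rowP => k; rewrite !mxE big_cons (negbTE jS).
Qed.

Lemma ket_stabilizer_basis N : is_stabilizer_basis (@ket N).
Proof.
exists (fun j => zstring [set j]); split.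
- by move=> j; exists false, (fun i => if i \in [set j] then inord 3 else ord0);
    rewrite scale1r zstring_pauli.
- by move=> j k; apply: zstringC.
(* Independence: for [i] in [S] the diagonal entry is -1 at index [2 ^ i] but 1 at index 0, so the
   product is not scalar. *)
- move=> S /set0Pn[i iS] [a]; rewrite prod_zstring => /matrixP ScalS.
  have := ScalS (Ordinal (ltn_bit i)) (Ordinal (ltn_bit i)).
  rewrite zstring_diag zsignX iS !mxE eqxx -[RHS]/a => Da.
  have /eqP := ScalS (ord0X N) (ord0X N).
  by rewrite zstring_diag zsign0 !mxE eqxx -[a *+ true]/a -Da eq_sym eqNr oner_eq0.
- by move=> b j; exists (zsign [set j] b); apply: zstring_ket.
- by move=> b b'; apply: ket_orthonormal.
Qed.

(** * The magic state and the one-pair measurement *)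

(* Amplitudes of THTH|0>, the single-qubit state with Bloch vector (1/2, -1/2, 1/sqrt 2). *)
Definition magic : bool -> algC :=
  gate1 Tg (gate1 Hg (gate1 Tg (gate1 Hg (fun x => (x == false)%:R)))).

(** The amplitude of Bell outcome [(b1, b2)] on data input |a>: [b1] is read on the data qubit and
    [b2] on the ancilla. *)
Definition bell_amp (b1 b2 a : bool) : algC := Hg b1 a * magic (b2 (+) a).

Lemma sqrtC2_neq0 : sqrtC 2 != 0 :> algC.
Proof. by rewrite sqrtC_eq0 pnatr_eq0. Qed.

Lemma conj_sqrtC2 : (sqrtC 2)^* = sqrtC 2 :> algC.
Proof. by rewrite conj_Creal // ger0_real // sqrtC_ge0 ler0n. Qed.

Lemma conj_omega8 : omega8^* = (1 - 'i) / sqrtC 2.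
Proof.
by rewrite /omega8 fmorph_div rmorphD rmorph1 /= conjCi conj_sqrtC2.
Qed.

Lemma omega8_conj : omega8 * omega8^* = 1.
Proof.
have s2 := sqrtCK (2 : algC); have i2 := sqrCi algC; have s0 := sqrtC2_neq0.
transitivity ((1 - 'i ^+ 2) / sqrtC 2 ^+ 2 : algC); last by rewrite s2 i2 opprK divff ?(pnatr_eq0 _ 2).
by rewrite conj_omega8 /omega8; field.
Qed.

Lemma omega8_sqr : omega8 ^+ 2 = 'i.
Proof.
rewrite /omega8 expr_div_n sqrtCK sqrrD sqrCi expr1n mul1r addrAC subrr add0r.
by rewrite -mulr_natr mulfK // pnatr_eq0.
Qed.

Lemma magic0 : magic false = (1 + omega8) / 2.
Proof.
rewrite /magic /gate1 !big_bool /Tg /Hg /= !(mul0r, mulr0, addr0, add0r, mul1r, mulr1).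
have := sqrtCK (2 : algC); move: omega8 (sqrtC 2) sqrtC2_neq0 => w s s0 <-.
by field.
Qed.

Lemma magic1 : magic true = omega8 * (1 - omega8) / 2.
Proof.
rewrite /magic /gate1 !big_bool /Tg /Hg /= !(mul0r, mulr0, addr0, add0r, mul1r, mulr1).
have := sqrtCK (2 : algC); move: omega8 (sqrtC 2) sqrtC2_neq0 => w s s0 <-.
by field.
Qed.

(** The entry in row [x (+) d], column [x] of the projector onto the magic state. *)
Definition magic_corr (d x : bool) : algC := (magic x)^* * magic (x (+) d).

(** The difference of the two squares is <Z> for [d = false] and i<X><Y> for [d = true], so this is
    where all three Bloch components must be nonzero. It is also the determinant of the circulant
    inverted in [bell_dual]. *)
Lemma magic_corr_neq (d : bool) : magic_corr d false ^+ 2 != magic_corr d true ^+ 2.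
Proof.
have i2 := sqrCi algC; have w2 := omega8_sqr; have w1 := omega8_conj.
have two0 : (2 : algC) != 0 by rewrite pnatr_eq0.
have c0 : (magic false)^* = (1 + omega8^*) / 2.
  by rewrite magic0 fmorph_div rmorphD rmorph1 rmorph_nat.
have c1 : (magic true)^* = omega8^* * (1 - omega8^*) / 2.
  by rewrite magic1 fmorph_div rmorphM rmorphB rmorph1 rmorph_nat.
have v2 : omega8^* ^+ 2 = - 'i by rewrite -rmorphXn /= w2 conjCi.
rewrite -subr_eq0 /magic_corr; case: d => /=; rewrite c0 c1 magic0 magic1.
  move: omega8 omega8^* w1 w2 v2 => w v w1 w2 v2.
  have -> : (1 + v) / 2 * (w * (1 - w) / 2) = (1 - 'i) / 4.
    by rewrite -w2 -(mulr1 v); field: w1.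
  have -> : v * (1 - v) / 2 * ((1 + w) / 2) = (1 + 'i) / 4.
    by rewrite -['i]opprK -v2 -(mulr1 w); field: w1.
  have -> : ((1 - 'i) / 4) ^+ 2 - ((1 + 'i) / 4) ^+ 2 = - 'i / 4 :> algC by field.
  by rewrite mulf_neq0 ?oppr_eq0 ?neq0Ci ?invr_eq0 ?pnatr_eq0.
move: omega8 omega8^* w1 w2 v2 => w v w1 w2 v2.
have -> : (((1 + v) / 2) * ((1 + w) / 2)) ^+ 2 -
          (v * (1 - v) / 2 * (w * (1 - w) / 2)) ^+ 2 = (w + v) / 2.
  by field: w1.
(* If [w + v] vanished, the squares 'i of [w] and -'i of [v] would agree. *)
rewrite mulf_neq0 ?invr_eq0 //; apply/eqP => wv0.
have /eqP := v2; rewrite -(addr0_eq wv0) sqrrN w2 -addr_eq0 -mulr2n -mulr_natl.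
by rewrite mulf_eq0 (negbTE two0) (negbTE (neq0Ci _)).
Qed.

(** The entry [(a, a')] of the one-qubit POVM element with outcome [(b1, b2)]. *)
Definition bell_kernel (b1 b2 a a' : bool) : algC :=
  (bell_amp b1 b2 a)^* * bell_amp b1 b2 a'.

(** The two Hadamard signs combine into a character of [b1] at [a (+) a'], while [b2] enters only as
    a translation. This exposes a Fourier transform in [b1] and a circulant in [b2]. *)
Lemma bell_kernelE b1 b2 a a' :
  bell_kernel b1 b2 a a' =
  (-1) ^+ (b1 && (a (+) a')) / 2 * magic_corr (a (+) a') (b2 (+) a).
Proof.
have s2 := sqrtCK (2 : algC).
have conjH x y : (Hg x y)^* = Hg x y.
  by rewrite /Hg fmorph_div /= conj_sqrtC2; case: ifP; rewrite ?rmorphN rmorph1.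
rewrite /bell_kernel /bell_amp /magic_corr rmorphM /= conjH mulrACA.
rewrite addbA -(addbA b2) addbb addbF; congr (_ * _).
rewrite /Hg mulrACA -invfM -expr2 s2; congr (_ / _).
by case: b1 a a' => [] [] []; rewrite /= ?(mulr1, mul1r, mulN1r, opprK, expr0, expr1).
Qed.

(* Inverting the Fourier transform in [b1] and then the 2x2 circulant
   matrix with entries [magic_corr d (b2 (+) a)]. *)
Definition bell_dual (b1 b2 a a' : bool) : algC :=
  let d := a (+) a' in
  (-1) ^+ (b1 && d) * (-1) ^+ (b2 (+) a) * magic_corr d (b2 (+) a) /
  (magic_corr d false ^+ 2 - magic_corr d true ^+ 2).

(** For fixed [d = a (+) a'], the sum over [a] of the [magic_corr] products is an alternating sum:
    it equals the denominator if [b2 = c2] and cancels otherwise. Averaging the remaining signs over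
    [d] then forces [b1 = c1]. *)
Lemma bell_dualP b1 b2 c1 c2 :
  \sum_(a : bool) \sum_(a' : bool) bell_kernel b1 b2 a a' * bell_dual c1 c2 a a' =
  ((b1 == c1) && (b2 == c2))%:R.
Proof.
have nz d : magic_corr d false ^+ 2 - magic_corr d true ^+ 2 != 0.
  by rewrite subr_eq0 magic_corr_neq.
have nzt := nz true; have nzf := nz false.
rewrite !big_bool !bell_kernelE /bell_dual.
by case: b1 b2 c1 c2 => [] [] [] []; rewrite /=; field; rewrite nzt nzf.
Qed.

(** * The circuit and the states it produces *)

Lemma circuit_mx_cat N (c1 c2 : seq (gate N)) :
  circuit_mx (c1 ++ c2) = circuit_mx c2 *m circuit_mx c1.
Proof. by elim: c1 => [|g c1 IHc] /=; rewrite ?mulmx1 // IHc mulmxA. Qed.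

Lemma circuit_mx_cons N g (c : seq (gate N)) : circuit_mx (g :: c) = circuit_mx c *m gate_mx g.
Proof. by []. Qed.

Lemma split_lshift m n (j : 'I_m) : split (lshift n j) = inl j.
Proof. exact: (unsplitK (inl j)). Qed.

Lemma split_rshift m n (j : 'I_n) : split (rshift m j) = inr j.
Proof. exact: (unsplitK (inr j)). Qed.

Lemma gate1_basis G a x : gate1 G (fun y => (y == a)%:R) x = G x a.
Proof. by rewrite /gate1 big_bool; case: a; rewrite /= !(mulr0, mulr1, addr0, add0r). Qed.

Section BellCircuit.
Variable n : nat.

(** The first four gates prepare [magic] on the ancilla. The CNOT and the last Hadamard carry the
    Bell basis of the pair to the computational basis, so measuring in [ket] suffices. *)
Definition bell_block (j : 'I_n) : seq (gate (n + n)) :=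
  [:: GH (rshift n j); GT (rshift n j); GH (rshift n j); GT (rshift n j);
      GCNOT (lshift n j) (rshift n j); GH (lshift n j)].

Definition pair_vec (d anc : 'I_n -> bool -> algC) : 'cV[algC]_(2 ^ (n + n)) :=
  prod_vec (fun i => match split i with inl j => d j | inr j => anc j end).

(* The state after the blocks of the pairs in [s] have been applied to |a>|0>. *)
Definition bell_state (s : seq 'I_n) (a : 'I_n -> bool) : 'cV[algC]_(2 ^ (n + n)) :=
  pair_vec (fun j x => if j \in s then Hg x (a j) else (x == a j)%:R)
           (fun j x => if j \in s then magic (x (+) a j) else (x == false)%:R).

Lemma bell_block_state (j : 'I_n) (s : seq 'I_n) (a : 'I_n -> bool) : j \notin s ->
  circuit_mx (bell_block j) *m bell_state s a = bell_state (j :: s) a.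
Proof.
move=> js; rewrite /bell_block !circuit_mx_cons /= mul1mx -!mulmxA.
(* As [j] is not in [s], its data qubit still holds the basis value [a j], which is the control
   value of the CNOT. *)
rewrite /bell_state /pair_vec !embed1_prod_vec !eqxx (@cnot_prod_vec _ _ _ _ (a j)).
- rewrite embed1_prod_vec; apply: eq_prod_vec => i x.
  case: (splitP i) => k Hk.
    have -> : i = lshift n k by exact/val_inj.
    rewrite !eq_lshift !eq_lrshift split_lshift inE.
    by case: eqVneq => [->|//]; rewrite (negbTE js) gate1_basis.
  have -> : i = rshift n k by exact/val_inj.
  rewrite !eq_rshift !eq_rlshift split_rshift inE.
  by case: eqVneq => [->|//]; rewrite eqxx (negbTE js).
- by rewrite eq_lrshift.
- by move=> x; rewrite !eq_lrshift split_lshift (negbTE js).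
Qed.

Definition bell_circuit (s : seq 'I_n) : seq (gate (n + n)) :=
  foldr (fun j c => c ++ bell_block j) [::] s.

Lemma bell_circuit_state (s : seq 'I_n) (a : 'I_n -> bool) : uniq s ->
  circuit_mx (bell_circuit s) *m bell_state [::] a = bell_state s a.
Proof.
elim: s => [|j s IHs] /=; first by rewrite mul1mx.
by case/andP=> js us; rewrite circuit_mx_cat -mulmxA IHs // bell_block_state.
Qed.

Lemma bell_circuit_wf s : all (@wf_gate (n + n)) (bell_circuit s).
Proof. by elim: s => //= j s IHs; rewrite all_cat IHs /= eq_lrshift. Qed.

Lemma bell_circuit_T s : count (@is_T (n + n)) (bell_circuit s) = (2 * size s)%N.
Proof. by elim: s => //= j s IHs; rewrite count_cat IHs /= mulnS addnC. Qed.

(** T changes only the |1> amplitude, which is zero on a fresh ancilla; such gates raise the T count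
    at no other effect. *)
Lemma T_state0 (j : 'I_n) a k :
  circuit_mx (nseq k (GT (rshift n j))) *m bell_state [::] a = bell_state [::] a.
Proof.
elim: k => [|k IHk]; first by rewrite mul1mx.
rewrite circuit_mx_cons -mulmxA -[RHS]IHk; congr (_ *m _).
rewrite /= embed1_prod_vec; apply: eq_prod_vec => i x.
case: eqVneq => [->|//]; rewrite split_rshift gate1_basis.
by case: x.
Qed.

(** The remainder and quotient of [k] by [2 ^ n] are its data and ancilla bits, so both index tests
    split into one test per qubit. *)
Lemma anc_embed_ket0 (a : 'I_(2 ^ n)) :
  col a (anc_embed n (ket (ord0X n))) = bell_state [::] (fun j => bit j a).
Proof.
apply/colP => k; rewrite !mxE big_split_ord /= eqxx andbT.
rewrite [X in _ = X * _](eq_bigr (fun j : 'I_n => (bit j k == bit j a)%:R)); last first.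
  by move=> j _; rewrite split_lshift.
rewrite [X in _ = _ * X](eq_bigr (fun j : 'I_n => (bit (n + j) k == false)%:R)); last first.
  by move=> j _; rewrite split_rshift.
rewrite !prod_indicator.
have lt_mod : (k %% 2 ^ n < 2 ^ n)%N by rewrite ltn_mod expn_gt0.
rewrite -[(k %% 2 ^ n)%N]/(val (Ordinal lt_mod)) val_eqE.
have -> : (Ordinal lt_mod == a) = [forall j : 'I_n, bit j k == bit j a].
  apply/bitsP/forallP => Hj j; last by rewrite /= bit_mod //; apply/eqP.
  by rewrite -Hj /= bit_mod.
have -> : (anc_index k == ord0X n) = [forall j : 'I_n, bit (n + j) k == false].
  apply/bitsP/forallP => Hj j; last by rewrite bit0n /= bit_div; apply/eqP.
  by rewrite -bit_div [bit _ _]Hj bit0n.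
by case: ifP; rewrite ?mul1r ?mul0r.
Qed.

(** * The resulting POVM and its completeness *)

Definition pair_index (b : 'I_(2 ^ (n + n))) (j : 'I_n) : bool * bool :=
  (bit (lshift n j) b, bit (rshift n j) b).

Lemma pair_index_eq b c : (b == c) = [forall j, pair_index b j == pair_index c j].
Proof.
apply/bitsP/forallP => [Hbc j|Heq i]; first by rewrite /pair_index !Hbc.
by case: (splitP i) => j Hj; rewrite Hj; have /eqP[] := Heq j.
Qed.

Definition bell_povm (b : 'I_(2 ^ (n + n))) : 'M[algC]_(2 ^ n) :=
  \matrix_(a, a') \prod_(j < n)
    bell_kernel (pair_index b j).1 (pair_index b j).2 (bit j a) (bit j a').

Lemma bell_povmE (i : 'I_n) k b :
  bell_povm b = povm_elt (ket (ord0X n))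
    (circuit_mx (nseq k (GT (rshift n i)) ++ bell_circuit (enum 'I_n))) (ket b).
Proof.
set U := circuit_mx _; pose W := U *m anc_embed n (ket (ord0X n)).
(* Column [a] of [W] is the circuit output on |a>|0>, a product state, so its amplitude at [b]
   factors over the pairs. *)
have WE a : W b a = \prod_(j < n) bell_amp (pair_index b j).1 (pair_index b j).2 (bit j a).
  transitivity (col a W b 0); first by rewrite [RHS]mxE.
  rewrite /W colE -mulmxA -colE anc_embed_ket0 /U circuit_mx_cat -mulmxA T_state0.
  rewrite bell_circuit_state ?enum_uniq // mxE big_split_ord /= -big_split /=.
  apply: eq_bigr => j _; rewrite split_lshift split_rshift.
  by rewrite mem_enum inE.
(* Each element has rank one: it is the Gram matrix of row [b] of [W]. *)
have -> : povm_elt (ket (ord0X n)) U (ket b) = adj (row b W) *m row b W.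
  have -> : row b W = adj (ket b) *m W.
    by rewrite rowE; congr (_ *m _); rewrite /adj map_delta_mx trmx_delta.
  have adjM p q r (A : 'M_(p, q)) (B : 'M_(q, r)) : adj (A *m B) = adj B *m adj A.
    by rewrite /adj map_mxM trmx_mul.
  have adjK p q (A : 'M_(p, q)) : adj (adj A) = A by apply/matrixP => u v; rewrite !mxE conjCK.
  by rewrite /povm_elt /W !adjM adjK !mulmxA.
clearbody W; apply/matrixP => a a'.
by rewrite !mxE big_ord1 !mxE !WE rmorph_prod -big_split.
Qed.

(** Tensor products of the one-pair duals form a dual family, that is, a right inverse of the matrix
    of elements. Its rows are thus independent, and there are [2 ^ (n + n)] of them, which is
    [4 ^ n]. *)
Lemma bell_povm_complete : informationally_complete n (2 ^ (n + n)) bell_povm.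
Proof.
pose D : 'M[algC]_(2 ^ (n + n), 2 ^ n * 2 ^ n) := \matrix_b mxvec (\matrix_(a, a')
   \prod_(j < n) bell_dual (pair_index b j).1 (pair_index b j).2 (bit j a) (bit j a')).
rewrite /informationally_complete; set M := \matrix_b _.
have MD : M *m D^T = 1%:M.
  apply/matrixP => b c; rewrite [LHS]mxE [RHS]mxE pair_index_eq -prod_indicator.
  pose F j x y := bell_kernel (pair_index b j).1 (pair_index b j).2 x y *
                  bell_dual (pair_index c j).1 (pair_index c j).2 x y.
  transitivity (\sum_(a < 2 ^ n) \sum_(a' < 2 ^ n) \prod_(j < n) F j (bit j a) (bit j a')).
    (* The columns of [mxvec] are reindexed by pairs [(a, a')]. *)
    rewrite pair_bigA (reindex _ (curry_mxvec_bij _ _)) /=.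
    by apply: eq_bigr => -[a a'] _; rewrite !mxE !mxvecE !mxE [RHS]big_split.
  by rewrite sum2_prod_bit; apply: eq_bigr => j _; rewrite bell_dualP.
have /eqP -> : row_free M by apply/row_freeP; exists D^T.
by rewrite addnn -mul2n expnM.
Qed.
End BellCircuit.

Theorem theorem5 (n t : nat) : (1 <= n)%N -> (2 * n <= t)%N ->
  exists (m : nat) (mu : 'I_(2 ^ (n + m)) -> 'M[algC]_(2 ^ n)),
    is_t_doped_POVM n t m mu /\ informationally_complete n (2 ^ (n + m)) mu.
Proof.
move=> n_gt0 le_2n_t; exists n, (@bell_povm n); split; last exact: bell_povm_complete.
(* Ancilla 0 exists because [n] is positive; it takes the surplus T gates before any block acts on
   it. *)
pose T0 := GT (rshift n (Ordinal n_gt0)).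
exists (ket (ord0X n)), (nseq (t - 2 * n) T0 ++ bell_circuit (enum 'I_n)), (@ket _).
split.
- exact: ket0_stabilizer.
- by rewrite all_cat bell_circuit_wf all_nseq orbT.
- by rewrite count_cat count_nseq bell_circuit_T size_enum_ord mul1n subnK.
- exact: ket_stabilizer_basis.
- by move=> b; apply: bell_povmE.
Qed.
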